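(* Let $\mathcal{O}$ be a finite set, let $s \geq 1$ be an integer, and let $f : 2^{\mathcal{O}} \to \mathbb{R}$ be a normalized, monotone decreasing, and $\alpha$-supermodular set function (so that $f(\mathcal{X}) \leq 0$ for all $\mathcal{X} \subseteq \mathcal{O}$). Let $\mathcal{X}^\star \in \operatorname{argmin}_{\mathcal{X} \subseteq \mathcal{O},\, |\mathcal{X}| \leq s} f(\mathcal{X})$. Then the set $\mathcal{G}_r$ obtained after $r$ steps of the greedy algorithm obeys $$f(\mathcal{G}_r) \leq \left(1 - e^{-\alpha r/s}\right) f(\mathcal{X}^\star).$$
   Context: For a set function $f : 2^{\mathcal{O}} \to \mathbb{R}$, $\mathcal{X} \subseteq \mathcal{O}$ and $u \in \mathcal{O} \setminus \mathcal{X}$, let $\Delta_u f(\mathcal{X}) = f(\mathcal{X}) - f(\mathcal{X} \cup \{u\})$. $f$ is normalized if $f(\emptyset) = 0$. $f$ is monotone decreasing if $f(\mathcal{A}) \geq f(\mathcal{B})$ for all $\mathcal{A} \subseteq \mathcal{B} \subseteq \mathcal{O}$. For $\alpha \in \mathbb{R}$, $f$ is $\alpha$-supermodular if for all $\mathcal{A} \subseteq \mathcal{B} \subseteq \mathcal{O}$ and all $u \in \mathcal{O} \setminus \mathcal{B}$ it holds that $\Delta_u f(\mathcal{A}) \geq \alpha\, \Delta_u f(\mathcal{B})$. Greedy algorithm: $\mathcal{G}_0 = \emptyset$ and $\mathcal{G}_{j+1} = \mathcal{G}_j \cup \{u\}$ with $u \in \operatorname{argmin}_{w \in \mathcal{O}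 \setminus \mathcal{G}_j} f(\mathcal{G}_j \cup \{w\})$ (ties broken arbitrarily). The number of steps $r$ is a nonnegative integer with $r \leq |\mathcal{O}|$, so that every step is defined. *)

(* Defs.v *)
From HB Require Import structures.
From mathcomp Require Import all_boot all_order all_algebra.
From mathcomp Require Import reals.

Set Implicit Arguments.
Unset Strict Implicit.
Unset Printing Implicit Defensive.

Import Order.TTheory GRing.Theory Num.Theory.
Local Open Scope ring_scope.

Section SetFunctions.
Variables (R : realType) (O : finType).
Implicit Types (f : {set O} -> R) (A B X G : {set O}) (u w : O).

(* The order is f(X) - f(X U {u}), so that a decreasing f has nonnegative
   increments; only meant for u \notin X. *)
Definition Delta u f X : R := f X - f (u |: X).

Definition normalized f : Prop := f set0 = 0.

Definition monotone_decreasing f : Prop :=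
  forall A B, A \subset B -> f B <= f A.

Definition alpha_supermodular (alpha : R) f : Prop :=
  forall A B u, A \subset B -> u \notin B ->
    alpha * Delta u f B <= Delta u f A.

Definition is_argmin (T : Type) (P : T -> Prop) (F : T -> R) (x : T) : Prop :=
  P x /\ forall y, P y -> F x <= F y.

(* A relation rather than a function: ties in the argmin are broken
   arbitrarily, so [greedy f r G] holds for every possible outcome G of r
   steps. *)
Inductive greedy f : nat -> {set O} -> Prop :=
| greedy0 : greedy f 0%N set0
| greedyS j G u :
    greedy f j G ->
    is_argmin (fun w => w \notin G) (fun w => f (w |: G)) u ->
    greedy f j.+1 (u |: G).

End SetFunctions.

(* Main.v *)
Require Import Defs.
From HB Require Import structures.
From mathcomp Require Import all_boot all_order all_algebra.
From mathcomp Require Import reals sequences exp.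
From mathcomp Require Import ring lra.

(** Write [h j] for the gap [f (G_j) - f Xstar] after [j] greedy steps, and let
    first [0 <= alpha].  Add the elements of [Xstar] to [G_j] one at a time: by
    alpha-supermodularity, [alpha] times the decrease of [f] at each addition
    is at most what the same element would gain on [G_j] itself, hence at most
    the greedy gain [h j - h j.+1].  As [Xstar] has at most [s] elements and
    [f (G_j :|: Xstar) <= f Xstar], this gives
    [alpha * h j <= s * (h j - h j.+1)] ([union_gain_le], [greedy_step_gain]),
    that is, [h j.+1 <= (1 - alpha / s) * h j].  Since [1 - x <= expR (- x)], a
    positive gap is multiplied by at most [expR (- (alpha / s))] at each step,
    and a nonpositive one stays nonpositive ([greedy_gap_le]).  The gap starts
    from [h 0 = - f Xstar].

    For [alpha < 0] the factor [1 - expR (- (alpha * r / s))] is nonpositive, so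
    the bound is nonnegative while [f G <= 0]. *)

Set Implicit Arguments.
Unset Strict Implicit.
Unset Printing Implicit Defensive.

Import Order.TTheory GRing.Theory Num.Theory.
Local Open Scope ring_scope.

Lemma normalized_decreasing_le0 (R : realType) (O : finType)
    (f : {set O} -> R) (X : {set O}) :
  normalized f -> monotone_decreasing f -> f X <= 0.
Proof. by move=> f0 fdec; rewrite -f0; apply: fdec; exact: sub0set. Qed.

(** Telescoping along an enumeration of [X]: each new element [u] enters a
    superset of [G], where its gain times [alpha] is at most its gain on [G];
    elements already present contribute nothing, whence [0 <= d]. *)
Lemma union_gain_le (R : realType) (O : finType) (alpha d : R)
    (f : {set O} -> R) (G X : {set O}) :
  alpha_supermodular alpha f -> 0 <= d ->
  (forall u, u \notin G -> Delta u f G <= d) ->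
  alpha * (f G - f (G :|: X)) <= #|X|%:R * d.
Proof.
move=> fsup d0 gain_le.
have [n cardX] := ubnP #|X|; elim: n X cardX => // n IHn X.
have [->|[u uX]] := set_0Vmem X.
  by rewrite setU0 subrr mulr0 cards0 mul0r.
rewrite (cardsD1 u) uX ltnS => /IHn; set Y := X :\ u => IHY.
have eqX : G :|: X = u |: (G :|: Y) by rewrite setUCA setD1K.
rewrite natrD mulrDl mul1r eqX.
have [uGY|uNGY] := boolP (u \in G :|: Y).
  by rewrite (setUidPr _) ?sub1set //; lra.
have uNG : u \notin G by apply: contra uNGY => uG; rewrite inE uG.
have /(_ uNGY) := fsup G (G :|: Y) u (subsetUl _ _).
have := gain_le u uNG; rewrite /Delta => ? ?; nra.
Qed.

Lemma greedy_step_gain (R : realType) (O : finType) (s : nat) (alpha : R)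
    (f : {set O} -> R) (X G : {set O}) (u : O) :
  0 <= alpha -> monotone_decreasing f -> alpha_supermodular alpha f ->
  (#|X| <= s)%N ->
  is_argmin (fun w => w \notin G) (fun w => f (w |: G)) u ->
  alpha * (f G - f X) <= s%:R * (f G - f (u |: G)).
Proof.
move=> alpha0 fdec fsup cardX [_ umin].
have gain0 : 0 <= f G - f (u |: G).
  by rewrite subr_ge0; apply: fdec; exact: subsetUr.
apply: (@le_trans _ _ (alpha * (f G - f (G :|: X)))).
  by apply: ler_wpM2l => //; rewrite lerB //; apply: fdec; exact: subsetUr.
apply: (@le_trans _ _ (#|X|%:R * (f G - f (u |: G)))).
  by apply: union_gain_le => // w wNG; rewrite /Delta lerB // umin.
by rewrite ler_wpM2r // ler_nat.
Qed.

(** While the gap is positive, [greedy_step_gain] and [1 - x <= expR (- x)] make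
    it shrink by the factor [expR (- (alpha / s))], even when [alpha > s] and
    [1 - alpha / s] is negative. *)
Lemma greedy_gap_le (R : realType) (O : finType) (s : nat) (alpha : R)
    (f : {set O} -> R) (X : {set O}) (r : nat) (G : {set O}) :
  (0 < s)%N -> 0 <= alpha ->
  normalized f -> monotone_decreasing f -> alpha_supermodular alpha f ->
  (#|X| <= s)%N -> greedy f r G ->
  f G - f X <= expR (- (alpha * r%:R / s%:R)) * - f X.
Proof.
move=> s_gt0 alpha0 f0 fdec fsup cardX.
have s0 : 0 < s%:R :> R by rewrite ltr0n.
have fX0 : f X <= 0 by exact: normalized_decreasing_le0.
elim=> {r G} [|r G u _ IH umin].
  by rewrite mulr0 mul0r oppr0 expR0 mul1r f0 sub0r.
have [gap_le0|gap_gt0] := leP (f G - f X) 0.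
  (* Past size [s] the greedy set may beat [X]; multiplying a negative gap by
     a factor below 1 would go the wrong way, but here monotonicity is
     enough. *)
  apply: (@le_trans _ _ 0).
    by apply: le_trans gap_le0; rewrite lerB // fdec // subsetUr.
  by rewrite mulr_ge0 ?expR_ge0 // oppr_ge0.
have -> : - (alpha * r.+1%:R / s%:R) =
          - (alpha / s%:R) + - (alpha * r%:R / s%:R).
  by rewrite -natr1; ring.
rewrite expRD -mulrA.
apply: le_trans (ler_wpM2l (expR_ge0 _) IH).
apply: (@le_trans _ _ ((1 - alpha / s%:R) * (f G - f X))).
  have := greedy_step_gain alpha0 fdec fsup cardX umin.
  rewrite [leRHS]mulrC -ler_pdivrMr // mulrAC => step.
  by rewrite mulrBl mul1r; lra.
by rewrite ler_wpM2r ?(ltW gap_gt0) // expR_ge1Dx.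
Qed.

Theorem theorem1 (R : realType) (O : finType) (s : nat) (alpha : R)
    (f : {set O} -> R) (Xstar : {set O}) (r : nat) (G : {set O})
    (hs : (1 <= s)%N)
    (f_normalized : normalized f)
    (f_decreasing : monotone_decreasing f)
    (f_supermodular : alpha_supermodular alpha f)
    (Xstar_opt : is_argmin (fun X : {set O} => (#|X| <= s)%N) f Xstar)
    (hr : (r <= #|O|)%N)
    (hG : greedy f r G) :
  f G <= (1 - expR (- (alpha * r%:R / s%:R))) * f Xstar.
Proof.
have [cardX _] := Xstar_opt.
have [alpha0|/ltW alpha0] := leP 0 alpha.
  have := greedy_gap_le hs alpha0 f_normalized f_decreasing f_supermodular
            cardX hG.
  by rewrite mulrBl mul1r mulrN; lra.
apply: (@le_trans _ _ 0); first exact: normalized_decreasing_le0.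
apply: mulr_le0; last exact: normalized_decreasing_le0.
rewrite subr_le0 -[leLHS]expR0 ler_expR oppr_ge0.
by rewrite -mulrA mulr_le0_ge0 ?divr_ge0.
Qed.
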